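(* Let $g:\mathbb R^m\to\mathbb R\cup\{+\infty\}$ be lsc and let $s_g$ be an epi-smoothing function for $g$. Furthermore, let $F:\mathbb R^n\to\mathbb R^m$ be continuously differentiable and metrically regular. Then $s_f:(x,\mu)\mapsto s_g(F(x),\mu)$ is an epi-smoothing function for $f:=g\circ F$.
   Context: For $f:\mathbb R^p\to\mathbb R\cup\{\pm\infty\}$, $\operatorname{epi} f:=\{(x,\alpha)\in\mathbb R^p\times\mathbb R\mid f(x)\le\alpha\}$; $f$ is lower semicontinuous (lsc) if $\operatorname{epi} f$ is closed. A sequence $f_k$ epi-converges to $f$ if $\operatorname{epi} f_k\to\operatorname{epi} f$ in the Painlevé–Kuratowski sense; equivalently, for every $\bar x$: (i) $\liminf_k f_k(x^k)\ge f(\bar x)$ for every sequence $x^k\to\bar x$, and (ii) there is a sequence $x^k\to\bar x$ with $\limsup_k f_k(x^k)\le f(\bar x)$. The notation $\mu_k\downarrow0$ means $\mu_k>0$ and $\mu_k\to0$. Epi-smoothing function: let $f:\mathbb R^p\to\mathbb R\cup\{+\infty\}$ be lsc. A function $s_f:\mathbb R^p\times\mathbb R_+\to\mathbb R$ is an epi-smoothing function for $f$ if (i) for every sequence $\mu_k\downarrow 0$, $s_f(\cdot,\mu_k)$ epi-converges to $f$, and (ii) $s_f(\cdot,\mu)$ is continuously differentiable for every $\mu>0$. (Only the values for $\mu>0$ matter.) Metric regularity: $F:\mathbb R^n\to\mathbb R^m$ is metrically regular at $\bar x$ if there exist $\gamma>0$ and neighborhoods $W$ of $\bar x$ and $V$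 of $F(\bar x)$ such that $\operatorname{dist}(x, F^{-1}(y))\le\gamma\|F(x)-y\|$ for all $x\in W$, $y\in V$, where $\operatorname{dist}(x,S)=\inf_{z\in S}\|x-z\|$ (Euclidean norm, $\inf\emptyset=+\infty$). $F$ is metrically regular if it is metrically regular at every $\bar x\in\mathbb R^n$. *)

(* Defs.v *)
From HB Require Import structures.
From mathcomp Require Import all_boot all_order all_algebra.
From mathcomp Require Import all_classical all_reals all_analysis.

Set Implicit Arguments.
Unset Strict Implicit.
Unset Printing Implicit Defensive.

Import Order.TTheory GRing.Theory Num.Theory.
Import numFieldNormedType.Exports.

Local Open Scope classical_set_scope.
Local Open Scope ring_scope.

Section PainleveKuratowski.
Context {T : topologicalType}.
Implicit Types (C : nat -> set T) (D : set T).

(* Limits of selections along some subsequence of C. *)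
Definition outer_limit C : set T :=
  [set x | exists phi : nat -> nat,
      {homo phi : i j / (i < j)%N >-> (i < j)%N} /\
      exists u : nat -> T, (forall k, C (phi k) (u k)) /\ u @ \oo --> x].

(* Limits of selections defined for all but finitely many indices. *)
Definition inner_limit C : set T :=
  [set x | exists u : nat -> T, (\forall k \near \oo, C k (u k)) /\ u @ \oo --> x].

Definition PK_converges C D : Prop := outer_limit C = D /\ inner_limit C = D.

End PainleveKuratowski.

Section EpiSmoothing.
Context {R : realType}.

Definition epi p (f : 'rV[R]_p -> \bar R) : set ('rV[R]_p * R) :=
  [set z | (f z.1 <= z.2%:E)%E].

Definition lsc p (f : 'rV[R]_p -> \bar R) : Prop := closed (epi f).

Definition epi_converges p (fk : nat -> 'rV[R]_p -> \bar R)
    (f : 'rV[R]_p -> \bar R) : Prop :=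
  PK_converges (fun k => epi (fk k)) (epi f).

(* The second clause is continuity of x |-> 'd f x for the operator norm. *)
Definition continuously_differentiable (V W : normedModType R)
    (f : V -> W) : Prop :=
  (forall x, differentiable f x) /\
  (forall x (e : R), 0 < e ->
     \forall y \near x, forall v, `|'d f y v - 'd f x v| <= e * `|v|).

(* R_+ is represented by R: s is only ever evaluated at positive mu.
   The first two fields say that f maps into R u {+oo} and is lsc, which is
   part of being a function that can be epi-smoothed. *)
Record epi_smoothing p (f : 'rV[R]_p -> \bar R) (s : 'rV[R]_p -> R -> R) :
    Prop := EpiSmoothing {
  epi_smoothing_neqNy : forall x, f x != -oo%E ;
  epi_smoothing_lsc : lsc f ;
  epi_smoothing_cvg : forall mu : nat -> R,
    (forall k, 0 < mu k) -> mu @ \oo --> (0 : R) ->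
    epi_converges (fun k x => (s x (mu k))%:E) f ;
  epi_smoothing_C1 : forall mu : R, 0 < mu ->
    continuously_differentiable (fun x => s x mu)
}.

(* The library norm on 'rV[R]_n is the sup norm; it induces the same topology
   and the same derivatives as this one. *)
Definition enorm n (x : 'rV[R]_n) : R := Num.sqrt (\sum_i x ord0 i ^+ 2).

Definition edist_set n (x : 'rV[R]_n) (S : set 'rV[R]_n) : \bar R :=
  ereal_inf [set (enorm (x - z))%:E | z in S].

Definition metrically_regular_at n m (F : 'rV[R]_n -> 'rV[R]_m)
    (xbar : 'rV[R]_n) : Prop :=
  exists gamma : R, 0 < gamma /\
  exists (W : set 'rV[R]_n) (V : set 'rV[R]_m),
    nbhs xbar W /\ nbhs (F xbar) V /\
    forall x y, W x -> V y ->
      (edist_set x (F @^-1` [set y]) <= (gamma * enorm (F x - y))%:E)%E.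

Definition metrically_regular n m (F : 'rV[R]_n -> 'rV[R]_m) : Prop :=
  forall xbar, metrically_regular_at F xbar.

End EpiSmoothing.

(* Main.v *)
Require Import Defs.
From HB Require Import structures.
From mathcomp Require Import all_boot all_order all_algebra.
From mathcomp Require Import all_classical all_reals all_analysis.

(** Lower semicontinuity and smoothness pass from [g] to [g \o F] because [F] is
continuous and by the chain rule.  The content is epi-convergence, where the
two Painleve-Kuratowski inclusions behave differently.

- Outer limit: continuity of [F] is enough.  The map [(x, a) |-> (F x, a)] is
  continuous and, for every [h], pulls [epi h] back to [epi (h \o F)], so it
  sends a convergent selection of epigraphs of [gk \o F] to one of epigraphs of [gk].

- Inner limit: a selection [(y k, b k)] converging to [(F x, a)] has to be
  lifted through [F], that is, one needs [u k] converging to [x] with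
  [F (u k) = y k].  Metric regularity at [x] gives, for large [k],
  [edist_set x (F @^-1` [set y k]) <= gamma * enorm (F x - y k)], and the
  right-hand side tends to zero; this is [metrically_regular_at_lift].

Since inner limits always lie in outer limits, the two inclusions
[outer limit <= epi (g \o F) <= inner limit] force both limits to be
[epi (g \o F)]. *)

Set Implicit Arguments.
Unset Strict Implicit.

Import Order.TTheory GRing.Theory Num.Theory.
Import numFieldNormedType.Exports.

Local Open Scope classical_set_scope.
Local Open Scope ring_scope.

Lemma inner_limit_sub_outer_limit (T : topologicalType) (C : nat -> set T) :
  inner_limit C `<=` outer_limit C.
Proof.
move=> x [u [[N _ uC] ux]].
exists (addn^~ N); split; first by move=> i j; rewrite ltn_add2r.
exists (fun k => u (k + N)%N); split.
  by move=> k; apply: uC; exact: leq_addl.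
by apply: cvg_comp ux; exact: cvg_addnr.
Qed.

(** Convergence is in the sup norm, whereas metric regularity bounds the
Euclidean norm. *)
Lemma norm_le_enorm (R : realType) p (x : 'rV[R]_p) : `|x| <= enorm x.
Proof.
have ->: `|x| = mx_norm x by [].
rewrite mx_normrE; apply: bigmax_le => [|[i j] _ /=]; first exact: sqrtr_ge0.
rewrite (ord1 i) -(ler_sqr (normr_ge0 _) (sqrtr_ge0 _)) real_normK ?num_real//.
rewrite sqr_sqrtr; last by apply: sumr_ge0 => k _; exact: sqr_ge0.
by rewrite (bigD1 j)//= lerDl; apply: sumr_ge0 => k _; exact: sqr_ge0.
Qed.

Lemma enorm_continuous (R : realType) p : continuous (@enorm R p).
Proof.
move=> x.
have coord2_cvg i : (fun y : 'rV[R]_p => y ord0 i ^+ 2) @ x --> x ord0 i ^+ 2.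
  exact: cvg_comp (@coord_continuous R 1 p ord0 i x) (@exprn_continuous R 2 _).
have sum_cvg : (fun y : 'rV[R]_p => \sum_i y ord0 i ^+ 2) @ x -->
    \sum_i x ord0 i ^+ 2.
  exact: (cvg_big (@add_continuous R) _ (fun i _ => coord2_cvg i)).
exact: cvg_comp sum_cvg (@sqrt_continuous R _).
Qed.

Lemma enorm0 (R : realType) p : enorm (0 : 'rV[R]_p) = 0.
Proof.
by rewrite /enorm big1 ?sqrtr0// => i _; rewrite mxE expr0n.
Qed.

(** The infimum defining the distance need not be attained, hence the slack
[e]; the finite bound on the distance forces [S] to be nonempty. *)
Lemma edist_set_le_adherent (R : realType) p (x : 'rV[R]_p) S (r e : R) :
  (edist_set x S <= r%:E)%E -> 0 < e -> exists2 z, S z & enorm (x - z) < r + e.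
Proof.
move=> xSr e0.
have /ereal_inf_lt[_ [z Sz <-]] : (edist_set x S < (r + e)%:E)%E.
  by apply: le_lt_trans xSr _; rewrite lte_fin ltrDl.
by rewrite lte_fin => ?; exists z.
Qed.

(** Each [y k] close to [F x] has a preimage within distance
[gamma * enorm (F x - y k)] of [x], up to a slack that vanishes with [k]. *)
Lemma metrically_regular_at_lift (R : realType) n m (F : 'rV[R]_n -> 'rV[R]_m)
    (x : 'rV[R]_n) (y : nat -> 'rV[R]_m) :
  metrically_regular_at F x -> y @ \oo --> F x ->
  exists u : nat -> 'rV[R]_n,
    (\forall k \near \oo, F (u k) = y k) /\ u @ \oo --> x.
Proof.
move=> [gamma [gamma0 [W [V [Wx [VFx regWV]]]]]] yFx.
pose r k := gamma * enorm (F x - y k) + k.+1%:R^-1.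
have near_lift : \forall k \near \oo,
    exists z, F z = y k /\ enorm (x - z) < r k.
  near=> k.
  have := regWV x (y k) (nbhs_singleton Wx).
  have Vyk : V (y k) by near: k; exact: yFx.
  move=> /(_ Vyk) /(@edist_set_le_adherent _ _ _ _ _ k.+1%:R^-1).
  by rewrite invr_gt0 ltr0n => /(_ isT)[z Fz xz]; exists z.
have r0 : r @ \oo --> (0 : R).
  have Fxy0 : enorm (F x - y k) @[k --> \oo] --> (0 : R).
    have : F x - y k @[k --> \oo] --> F x - F x.
      by apply: cvgB => //; exact: cvg_cst.
    by move=> /cvg_comp/(_ (@enorm_continuous R m _)); rewrite subrr enorm0.
  have -> : (0 : R) = gamma * 0 + 0 by rewrite mulr0 addr0.
  exact: cvgD (cvgM (cvg_cst gamma) Fxy0) (@cvg_harmonic R).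
(* A preimage is available only for large [k]; the other terms of the sequence
   take the default value [0]. *)
have /choice[u uP] : forall k, exists z,
    (exists z, F z = y k /\ enorm (x - z) < r k) ->
    F z = y k /\ enorm (x - z) < r k.
  move=> k.
  have [[z ?]|?] := pselect (exists z, F z = y k /\ enorm (x - z) < r k).
    by exists z.
  by exists 0.
exists u; split; first by apply: filterS near_lift => k /uP[].
apply/cvgrPdist_lt => e e0.
have re : \forall k \near \oo, r k < e by exact: (cvgr_lt _ r0).
near=> k.
apply: le_lt_trans (norm_le_enorm _) _.
apply: (@lt_trans _ _ (r k)); last by near: k.
by have /uP[] : exists z, F z = y k /\ enorm (x - z) < r k by near: k.
Unshelve. all: by end_near.
Qed.

Lemma cvg_prod (T : Type) (A : set_system T) (U V : topologicalType)
    (f : T -> U) (g : T -> V) (a : U) (b : V) :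
  Filter A -> f @ A --> a -> g @ A --> b -> (f x, g x) @[x --> A] --> (a, b).
Proof. by move=> FA fa gb; exact: (cvg_pair fa gb). Qed.

Lemma continuous_map_fst (U V W : topologicalType) (f : U -> V) :
  continuous f -> continuous (fun z : U * W => (f z.1, z.2)).
Proof.
move=> f_cont [x a].
apply: (@cvg_prod _ (nbhs (x, a)) _ _ (f \o fst) snd).
  exact: (cvg_comp _ _ (@cvg_fst _ _ (nbhs x) (nbhs a) _) (f_cont x)).
exact: (@cvg_snd _ _ (nbhs x) (nbhs a) _).
Qed.

Lemma lsc_comp (R : realType) n m (g : 'rV[R]_m -> \bar R)
    (F : 'rV[R]_n -> 'rV[R]_m) :
  lsc g -> continuous F -> lsc (g \o F).
Proof.
move=> g_lsc F_cont; rewrite /lsc.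
have -> : epi (g \o F) = (fun z => (F z.1, z.2)) @^-1` epi g by [].
by apply: preimage_closed => // z _; exact: continuous_map_fst.
Qed.

(** Continuity of [F] pushes selections of epigraphs forward, which bounds the
outer limit; metric regularity lifts them back, which fills the inner limit. *)
Lemma epi_converges_comp (R : realType) n m (gk : nat -> 'rV[R]_m -> \bar R)
    (g : 'rV[R]_m -> \bar R) (F : 'rV[R]_n -> 'rV[R]_m) :
  continuous F -> metrically_regular F ->
  epi_converges gk g -> epi_converges (fun k => gk k \o F) (g \o F).
Proof.
move=> F_cont F_regular [outer_g inner_g].
have outer_sub : outer_limit (fun k => epi (gk k \o F)) `<=` epi (g \o F).
  move=> [x a] [phi [phi_mono [u [u_epi u_cvg]]]].
  suff : epi g (F x, a) by [].
  rewrite -outer_g; exists phi; split=> //.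
  exists (fun k => (F (u k).1, (u k).2)); split=> //.
  exact: cvg_comp u_cvg (@continuous_map_fst _ _ R F F_cont _).
have sub_inner : epi (g \o F) `<=` inner_limit (fun k => epi (gk k \o F)).
  move=> [x a] gFxa.
  have : epi g (F x, a) by [].
  rewrite -inner_g => -[v [v_epi v_cvg]].
  have v1 : (v k).1 @[k --> \oo] --> F x.
    exact: (cvg_comp _ _ v_cvg (@cvg_fst _ _ (nbhs (F x)) (nbhs a) _)).
  have v2 : (v k).2 @[k --> \oo] --> a.
    exact: (cvg_comp _ _ v_cvg (@cvg_snd _ _ (nbhs (F x)) (nbhs a) _)).
  have [u [Fu ux]] := metrically_regular_at_lift (F_regular x) v1.
  exists (fun k => (u k, (v k).2)); split; last exact: cvg_prod ux v2.
  by apply: filterS2 v_epi Fu => k; rewrite /epi/= => + ->.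
have inner_outer := inner_limit_sub_outer_limit (C := fun k => epi (gk k \o F)).
split; apply/seteqP; split=> //.
- exact: subset_trans sub_inner inner_outer.
- exact: subset_trans inner_outer outer_sub.
Qed.

Lemma diff_bounded (R : realType) (V W : normedModType R) (f : V -> W) x :
  differentiable f x ->
  exists2 M : R, 0 < M & forall v, `|'d f x v| <= M * `|v|.
Proof.
move=> fx.
have /linear_boundedP fM : bounded_near 'd f x (nbhs 0).
  by apply: continuous_linear_bounded; exact: diff_continuous.
near +oo_R => M; exists M => //.
by near: M.
Unshelve. all: by end_near.
Qed.

(** Near [x], the difference of the derivatives of [g \o f] at [y] and [x] is
[('d g (f y) - 'd g (f x)) \o 'd f y + 'd g (f x) \o ('d f y - 'd f x)].  The
first term is a bounded map followed by one of small norm, since [f y] is close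
to [f x]; the second is a map of small norm followed by a bounded one. *)
Lemma continuously_differentiable_comp (R : realType) (U V W : normedModType R)
    (f : U -> V) (g : V -> W) :
  continuously_differentiable f -> continuously_differentiable g ->
  continuously_differentiable (g \o f).
Proof.
move=> [df f_C1] [dg g_C1]; split=> [x|x e e0].
  exact: differentiable_comp.
have [M M0 fM] := diff_bounded (df x).
have [K K0 gK] := diff_bounded (dg (f x)).
(* [M + 1] will bound ['d f y] for [y] near [x]; each of the two terms gets half
   of [e]. *)
have e1_gt0 : 0 < e / 2 / (M + 1) by rewrite !divr_gt0// addr_gt0.
have e2_gt0 : 0 < e / 2 / K by rewrite !divr_gt0.
near=> y => v.
rewrite (diff_comp (df y) (dg (f y))) (diff_comp (df x) (dg (f x))) /=.
have fy1 : forall v, `|'d f y v - 'd f x v| <= 1 * `|v|.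
  by near: y; exact: f_C1.
have fy2 : forall v, `|'d f y v - 'd f x v| <= (e / 2 / K) * `|v|.
  by near: y; exact: f_C1.
have gy : forall v, `|'d g (f y) v - 'd g (f x) v| <= (e / 2 / (M + 1)) * `|v|.
  by near: y; exact: (differentiable_continuous (df x) (g_C1 (f x) _ e1_gt0)).
have fyM : `|'d f y v| <= (M + 1) * `|v|.
  rewrite -[X in `|X|](subrK ('d f x v)) mulrDl [leRHS]addrC.
  by apply: le_trans (ler_normD _ _) _; exact: lerD.
rewrite -[X in `|X|](subrKA ('d g (f x) ('d f y v))) -linearB.
apply: le_trans (ler_normD _ _) _.
rewrite [e]splitr mulrDl; apply: lerD.
  apply: le_trans (gy _) _.
  apply: le_trans (ler_wpM2l (ltW e1_gt0) fyM) _.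
  by rewrite mulrA divfK// gt_eqF// addr_gt0.
apply: le_trans (gK _) _.
by rewrite mulrC -ler_pdivlMr// mulrAC; exact: fy2.
Unshelve. all: by end_near.
Qed.

Unset Implicit Arguments.

Theorem theorem3p2 (R : realType) (n m : nat)
    (g : 'rV[R]_m -> \bar R) (s_g : 'rV[R]_m -> R -> R)
    (F : 'rV[R]_n -> 'rV[R]_m)
    (g_neqNy : forall y, g y != -oo%E) (g_lsc : lsc g)
    (s_g_smoothing : epi_smoothing g s_g)
    (F_C1 : continuously_differentiable F)
    (F_regular : metrically_regular F) :
  epi_smoothing (g \o F) (fun x mu => s_g (F x) mu).
Proof.
have F_cont : continuous F.
  by move=> x; apply: differentiable_continuous; exact: F_C1.1.
case: s_g_smoothing => _ _ s_cvg s_C1; split=> [x||mu mu_gt0 mu0|mu mu_gt0].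
- exact: g_neqNy.
- exact: lsc_comp.
- exact: (epi_converges_comp F_cont F_regular (s_cvg _ mu_gt0 mu0)).
- exact: continuously_differentiable_comp (s_C1 _ mu_gt0).
Qed.
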